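(* For any graph $G=([n],E)$ and any integer $r\ge0$, $$\frac1{\alpha(G)}\ \ge\ \frac1{\vartheta^{(2r)}(G)}=F_G^{(2r+2)}=f_{G,po}^{(r+1)}\ \ge\ f_G^{(r+1)}.$$
   Context: Graphs are finite and simple. $\alpha(G)$ is the maximum cardinality of a stable set, $A_G$ the adjacency matrix, $I$ the identity and $J$ the all-ones matrix. Set $f_G(x)=x^T(I+A_G)x$ and $F_G(x)=f_G(x_1^2,\dots,x_n^2)$. $\Sigma$ is the set of sums of squares of real polynomials in $x=(x_1,\dots,x_n)$, $\Sigma_r=\Sigma\cap\mathbb{R}[x]_{2r}$ (those of degree at most $2r$), and $\langle h\rangle_k=\{uh:u\in\mathbb{R}[x],\deg(uh)\le k\}$. Further, $\mathcal{M}(x_1,\dots,x_n)_r=\{\sigma_0+\sum_{j=1}^n\sigma_jx_j:\sigma_j\in\Sigma,\ \deg(\sigma_0)\le2r,\deg(\sigma_jx_j)\le2r\}$ (truncated quadratic module) and $\mathcal{T}(x_1,\dots,x_n)_r=\{\sum_{R\subseteq[n]}\sigma_R\prod_{j\in R}x_j:\sigma_R\in\Sigma,\ \deg(\sigma_R\prod_{j\in R}x_j)\le2r\}$ (truncated preordering). Define $$f_G^{(r)}=\sup\{\lambda:f_G-\lambda\in\mathcal{M}(x_1,\dots,x_n)_r+\langle1-\textstyle\sum_ix_i\rangle_{2r}\},$$ $$f_{G,po}^{(r)}=\sup\{\lambda:f_G-\lambda\in\mathcal{T}(x_1,\dots,x_n)_r+\langle1-\textstyle\sum_ix_i\rangle_{2r}\},$$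 $$F_G^{(r)}=\sup\{\lambda:F_G-\lambda\in\Sigma_r+\langle1-\textstyle\sum_ix_i^2\rangle_{2r}\},$$ with $\lambda\in\mathbb{R}$ and $\sup\emptyset=-\infty$. For $r\ge0$, $\mathcal{K}_n^{(r)}$ is the set of real symmetric $n\times n$ matrices $M$ with $(\sum_ix_i^2)^r\sum_{i,j}M_{ij}x_i^2x_j^2\in\Sigma$, and $\vartheta^{(r)}(G)=\min\{t\in\mathbb{R}:t(I+A_G)-J\in\mathcal{K}_n^{(r)}\}$. *)

(* Defs.v *)
From HB Require Import structures.
From mathcomp Require Import all_boot all_order all_algebra.
From mathcomp Require Import classical_sets reals constructive_ereal ereal.
(* The notations of [mpoly] are incompatible with those of [classical_sets];
   the few that are used are restated below. *)
From mathcomp Require Import -(notations) mpoly.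

Set Implicit Arguments.
Unset Strict Implicit.
Unset Printing Implicit Defensive.

Import Order.TTheory GRing.Theory Num.Theory.

Local Open Scope ring_scope.

Notation "{ 'mpoly' T [ n ] }" := (mpoly n T).
Notation "''X_' i" := (mpolyX _ (mnm1 i)).
Notation "c %:MP" := (mpolyC _ c).

(* A simple graph on [n] is a symmetric irreflexive [e : rel 'I_n]. *)

Definition stable (n : nat) (e : rel 'I_n) (S : {set 'I_n}) : bool :=
  [forall i in S, forall j in S, ~~ e i j].

Definition alpha (n : nat) (e : rel 'I_n) : nat :=
  \max_(S : {set 'I_n} | stable e S) #|S|.

Definition adjmx (R : realType) (n : nat) (e : rel 'I_n) : 'M[R]_n :=
  \matrix_(i, j) (e i j)%:R.

(* [msize p] is [1 + deg p], and [0] for [p = 0] (degree [-oo]). *)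
Definition deg_le (R : realType) (n : nat) (p : {mpoly R[n]}) (d : nat) : bool :=
  (msize p <= d.+1)%N.

Definition sos (R : realType) (n : nat) (p : {mpoly R[n]}) : Prop :=
  exists s : seq {mpoly R[n]}, p = \sum_(q <- s) q ^+ 2.

Definition sos_trunc (R : realType) (n r : nat) (p : {mpoly R[n]}) : Prop :=
  sos p /\ deg_le p (2 * r).

Definition ideal_trunc (R : realType) (n : nat) (h : {mpoly R[n]}) (k : nat)
    (p : {mpoly R[n]}) : Prop :=
  exists u : {mpoly R[n]}, deg_le (u * h) k /\ p = u * h.

Definition qmodule_trunc (R : realType) (n r : nat) (p : {mpoly R[n]}) : Prop :=
  exists (sigma0 : {mpoly R[n]}) (sigma : 'I_n -> {mpoly R[n]}),
    [/\ sos sigma0, deg_le sigma0 (2 * r),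
        forall j, sos (sigma j) /\ deg_le (sigma j * 'X_j) (2 * r) &
        p = sigma0 + \sum_(j < n) sigma j * 'X_j].

Definition preord_trunc (R : realType) (n r : nat) (p : {mpoly R[n]}) : Prop :=
  exists sigma : {set 'I_n} -> {mpoly R[n]},
    (forall S : {set 'I_n},
       sos (sigma S) /\ deg_le (sigma S * \prod_(j in S) 'X_j) (2 * r)) /\
    p = \sum_(S : {set 'I_n}) sigma S * \prod_(j in S) 'X_j.

Definition poly_sum (R : realType) (n : nat) (P Q : {mpoly R[n]} -> Prop)
    (p : {mpoly R[n]}) : Prop :=
  exists a b : {mpoly R[n]}, [/\ P a, Q b & p = a + b].

Definition fG (R : realType) (n : nat) (e : rel 'I_n) : {mpoly R[n]} :=
  \sum_(i < n) \sum_(j < n) (1%:M + adjmx R e) i j *: ('X_i * 'X_j).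

Definition FG (R : realType) (n : nat) (e : rel 'I_n) : {mpoly R[n]} :=
  comp_mpoly [tuple 'X_i ^+ 2 | i < n] (fG R e).

Definition simplex_poly (R : realType) (n : nat) : {mpoly R[n]} :=
  1 - \sum_(i < n) 'X_i.

Definition sphere_poly (R : realType) (n : nat) : {mpoly R[n]} :=
  1 - \sum_(i < n) 'X_i ^+ 2.

Definition sup_shift (R : realType) (n : nat) (p : {mpoly R[n]})
    (C : {mpoly R[n]} -> Prop) : \bar R :=
  ereal_sup [set lambda%:E | lambda in [set l : R | C (p - l%:MP)]]%classic.

Definition fG_bound (R : realType) (n : nat) (e : rel 'I_n) (r : nat) : \bar R :=
  sup_shift (fG R e)
    (poly_sum (@qmodule_trunc R n r) (ideal_trunc (simplex_poly R n) (2 * r))).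

Definition fG_po_bound (R : realType) (n : nat) (e : rel 'I_n) (r : nat) : \bar R :=
  sup_shift (fG R e)
    (poly_sum (@preord_trunc R n r) (ideal_trunc (simplex_poly R n) (2 * r))).

Definition FG_bound (R : realType) (n : nat) (e : rel 'I_n) (r : nat) : \bar R :=
  sup_shift (FG R e)
    (poly_sum (@sos_trunc R n r) (ideal_trunc (sphere_poly R n) (2 * r))).

Definition Kcone (R : realType) (n r : nat) (M : 'M[R]_n) : Prop :=
  M^T = M /\
  sos ((\sum_(i < n) 'X_i ^+ 2) ^+ r *
       \sum_(i < n) \sum_(j < n) M i j *: ('X_i ^+ 2 * 'X_j ^+ 2)
       : {mpoly R[n]}).

Definition is_vartheta (R : realType) (n : nat) (e : rel 'I_n) (r : nat)
    (t : R) : Prop :=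
  let feasible (s : R) :=
    Kcone r (s *: (1%:M + adjmx R e) - const_mx 1) in
  feasible t /\ forall s : R, feasible s -> t <= s.

(* Main.v *)
(* Write N for x_1^2 + ... + x_n^2. All the equalities come from one statement:
   the following are equivalent for a real number l.
   - F_G - l is a sum of squares of degree at most 4r+4 modulo 1 - N;
   - N^(2r) (F_G - l N^2) is a sum of squares;
   - f_G - l is in the truncated preordering modulo 1 - sum_i x_i.
   The first gives the second by homogenising with N = 1: in a square q^2 the
   terms of q of even and of odd degree contribute squares a^2 and N b^2, and the
   cross terms disappear. The converse is a geometric series in N. The third gives
   the first by substituting x_i^2 for x_i; conversely one extracts the terms that
   are even in every variable, and a square q^2 then splits as the sum over S of
   q_S^2 * prod_(j in S) x_j, where q_S collects the monomials of q whose odd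
   exponents are exactly those in S.
   For l > 0 the second statement says that 1/l is feasible for the program
   defining theta. The largest l exists because the sums of squares of bounded
   degree form a closed cone: Gram matrices are bounded by a functional that is
   positive definite on squares, hence converge along an ultrafilter, and a
   positive semidefinite limit is again a sum of squares. Evaluating at the
   indicator vector of a stable set gives theta >= alpha. *)
Require Import Defs.
From HB Require Import structures.
From mathcomp Require Import all_boot all_order all_algebra.
From mathcomp Require Import classical_sets reals constructive_ereal ereal.
From mathcomp Require Import boolp filter topology normedtype sequences.
From mathcomp Require Import ring lra zify.
From mathcomp Require Import -(notations) mpoly.

Set Implicit Arguments.
Unset Strict Implicit.
Unset Printing Implicit Defensive.

Import Order.TTheory GRing.Theory Num.Theory.

Local Open Scope ring_scope.

Local Notation "p @_ m" := (mcoeff m p) (at level 3, m at level 2, format "p @_ m") : ring_scope.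
Local Notation "m1 +m m2" := (mnm_add m1 m2) (at level 50, left associativity).

(** * Sums of squares and degrees *)

Section Sos.
Context (R : realType) (n : nat).
Implicit Types (p q : {mpoly R[n]}).

Lemma sos0 : sos (0 : {mpoly R[n]}).
Proof. by exists [::]; rewrite big_nil. Qed.

Lemma sosD p q : sos p -> sos q -> sos (p + q).
Proof. by move=> [s ->] [t ->]; exists (s ++ t); rewrite big_cat. Qed.

Lemma sos_sqr q : sos (q ^+ 2).
Proof. by exists [:: q]; rewrite big_seq1. Qed.

Lemma sos_sum (I : Type) (s : seq I) (P : pred I) (F : I -> {mpoly R[n]}) :
  (forall i, P i -> sos (F i)) -> sos (\sum_(i <- s | P i) F i).
Proof. by move=> h; elim/big_ind: _ => //; [exact: sos0|exact: sosD]. Qed.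

Lemma sosM p q : sos p -> sos q -> sos (p * q).
Proof.
move=> [s ->] [t ->]; rewrite mulr_suml; apply: sos_sum => a _.
by rewrite mulr_sumr; apply: sos_sum => b _; rewrite -exprMn; exact: sos_sqr.
Qed.

Lemma sosX p k : sos p -> sos (p ^+ k).
Proof.
move=> hp; elim: k => [|k ih]; last by rewrite exprS; exact: sosM.
by rewrite expr0 -(expr1n _ 2); exact: sos_sqr.
Qed.

Lemma sosZ c p : 0 <= c -> sos p -> sos (c *: p).
Proof.
move=> c0 [s ->]; rewrite scaler_sumr; apply: sos_sum => a _.
by rewrite -(sqr_sqrtr c0) -exprZn; exact: sos_sqr.
Qed.

Lemma sos_meval_ge0 p (v : 'I_n -> R) : sos p -> 0 <= meval v p.
Proof.
move=> [s ->]; rewrite raddf_sum sumr_ge0//= => q _.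
by rewrite expr2 mevalM -expr2 sqr_ge0.
Qed.

Lemma deg_leP p d : reflect (forall m, m \in msupp p -> (mdeg m <= d)%N) (deg_le p d).
Proof.
apply: (iffP idP) => [h m /msize_mdeg_lt lt_m|h]; first by rewrite -ltnS (leq_trans lt_m).
rewrite /deg_le msizeE big_tnth; apply/bigmax_leqP => i _.
by rewrite ltnS h // mem_tnth.
Qed.

Lemma deg_leD p q d : deg_le p d -> deg_le q d -> deg_le (p + q) d.
Proof.
move=> hp hq; apply: leq_trans (msizeD_le _ _) _.
by rewrite geq_max; apply/andP.
Qed.

Lemma deg_leN p d : deg_le (- p) d = deg_le p d.
Proof. by rewrite /deg_le msizeN. Qed.

Lemma deg_leW p d d' : (d <= d')%N -> deg_le p d -> deg_le p d'.
Proof. by move=> dd' hp; apply: leq_trans hp _. Qed.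

Lemma deg_le0 d : deg_le (0 : {mpoly R[n]}) d.
Proof. by rewrite /deg_le msize0. Qed.

Lemma deg_le_sum (I : Type) (s : seq I) (P : pred I) (F : I -> {mpoly R[n]}) d :
  (forall i, P i -> deg_le (F i) d) -> deg_le (\sum_(i <- s | P i) F i) d.
Proof. by move=> h; elim/big_ind: _ => //; [exact: deg_le0|move=> *; exact: deg_leD]. Qed.

Lemma deg_leZ c p d : deg_le p d -> deg_le (c *: p) d.
Proof. by move=> hp; apply: leq_trans (msizeZ_le _ _) _. Qed.

Lemma deg_leM p q d d' : deg_le p d -> deg_le q d' -> deg_le (p * q) (d + d').
Proof.
move=> /deg_leP hp /deg_leP hq; apply/deg_leP => m /msuppM_le.
by case/allpairsP => -[a b] /= [/hp ? /hq ? ->]; rewrite mdegD leq_add.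
Qed.

Lemma deg_leXn p d k : deg_le p d -> deg_le (p ^+ k) (k * d).
Proof.
move=> hp; elim: k => [|k ih]; first by rewrite /deg_le expr0 msize1.
by rewrite exprS mulSn deg_leM.
Qed.

Lemma deg_leX (m : multinom n) : deg_le (mpolyX R m) (mdeg m).
Proof. by rewrite /deg_le msizeX. Qed.

Lemma deg_leC c d : deg_le (c%:MP : {mpoly R[n]}) d.
Proof. by rewrite /deg_le msizeC; case: (c != 0). Qed.

(* The leading monomials of the squares cannot cancel: the coefficient of the
   double of the largest one is a nonzero sum of squares. *)
Lemma deg_le_sum_sqr (s : seq {mpoly R[n]}) d :
  deg_le (\sum_(q <- s) q ^+ 2) (2 * d) -> {in s, forall q, deg_le q d}.
Proof.
move=> hd q0 q0s; apply/negPn/negP => hq0.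
pose M := (\join_(q <- s) mlead q)%O.
have leM q : q \in s -> (mlead q <= M)%O by move=> qs; apply: joins_sup_seq.
have q0n0 : q0 != 0 by apply: contraNneq hq0 => ->; exact: deg_le0.
have dM : (d < mdeg M)%N.
  move: hq0; rewrite /deg_le -mlead_deg // -ltnNge ltnS => /leq_trans; apply.
  exact: lemc_mdeg (leM _ q0s).
have [q1 q1s q1M] : exists2 q, q \in s & mlead q = M.
  have : M \in [seq mlead (q : {mpoly R[n]}) | q <- s].
    rewrite /M; case: ssrcomplements.bigjoinP => [||q qs]; last exact: map_f.
    - exact: le_total.
    - by move: q0s; case: (s).
  by case/mapP => q qs ->; exists q.
have q1n0 : q1 != 0.
  by apply: contraTneq dM => q10; rewrite -q1M q10 mlead0 mdeg0.
(* A root whose leading monomial is below [M] fits the formula too: both sides are then 0. *)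
have cE q : q \in s -> (q ^+ 2)@_(M +m M) = q@_M ^+ 2.
  by move=> qs; rewrite expr2 mleadcMW ?leM // expr2.
have : (\sum_(q <- s) q ^+ 2)@_(M +m M) = 0.
  apply: memN_msupp_eq0; apply: msize_mdeg_ge.
  apply: leq_trans hd _; rewrite mdegD; lia.
rewrite raddf_sum /= big_seq (eq_bigr (fun q => q@_M ^+ 2)); last by move=> q /cE.
rewrite -big_seq => /eqP; rewrite psumr_eq0; last by move=> *; rewrite sqr_ge0.
move=> /allP /(_ _ q1s) /=; rewrite sqrf_eq0 -q1M mleadc_eq0.
exact/negP.
Qed.

End Sos.

(** * Homogenisation *)

Section MonomialLinear.
Context (R : realType) (n : nat).

(** Extending a map on monomials linearly yields all three operators used below: homogenisation, the
    even part and the moment functional. *)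
Definition mlin (V : lmodType R) (h : multinom n -> V) (p : {mpoly R[n]}) : V :=
  \sum_(m <- msupp p) p@_m *: h m.

Context (V : lmodType R) (h : multinom n -> V).
Implicit Types (p q : {mpoly R[n]}).

(** A common index set for [p], [q] and [c *: p + q] makes linearity a termwise identity. *)
Lemma mlinwE k p : (msize p <= k)%N ->
  mlin h p = \sum_(m : bmultinom n k) p@_m *: h m.
Proof.
move=> le_pk; rewrite /mlin (ssrcomplements.big_mksub (bmultinom n k)) ?msupp_uniq //=; last first.
  by move=> m /msize_mdeg_lt /leq_trans; apply.
by rewrite big_rmcond //= => m /memN_msupp_eq0 ->; rewrite scale0r.
Qed.

Fact mlin_is_linear : linear (mlin h).
Proof.
move=> c p q; pose k := maxn (msize (c *: p + q)) (maxn (msize p) (msize q)).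
have [hpq hp hq] : [/\ (msize (c *: p + q) <= k)%N, (msize p <= k)%N & (msize q <= k)%N].
  by rewrite /k !leq_max !leqnn !orbT.
rewrite !(@mlinwE k) // scaler_sumr -big_split; apply: eq_bigr => m _ /=.
by rewrite mcoeffD mcoeffZ scalerDl scalerA.
Qed.

HB.instance Definition _ :=
  GRing.isLinear.Build R {mpoly R[n]} V _ (mlin h) mlin_is_linear.

Lemma mlinX m : mlin h (mpolyX R m) = h m.
Proof. by rewrite /mlin msuppX big_seq1 mcoeffX eqxx scale1r. Qed.

Lemma mlin_sqr k q : (msize q <= k)%N ->
  mlin h (q ^+ 2) =
    \sum_(a : bmultinom n k) \sum_(b : bmultinom n k) (q@_a * q@_b) *: h (a +m b).
Proof.
move=> qk; rewrite {1}(mpolywE qk) expr2 big_distrlr linear_sum /=.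
apply: eq_bigr => a _; rewrite linear_sum /=; apply: eq_bigr => b _.
by rewrite -scalerAl -scalerAr scalerA -mpolyXD linearZ /= mlinX.
Qed.

End MonomialLinear.

Section Homogenise.
Context (R : realType) (n : nat).
Implicit Types (p q u : {mpoly R[n]}).

Definition sqnorm : {mpoly R[n]} := \sum_(i < n) 'X_i ^+ 2.

Lemma sos_sqnorm : sos sqnorm.
Proof. by apply: sos_sum => i _; exact: sos_sqr. Qed.

Lemma deg_le_sqnorm : deg_le sqnorm 2.
Proof.
apply: deg_le_sum => i _; have := @deg_leXn _ _ _ _ 2 (@deg_leX R _ (mnm1 i)).
by rewrite mdeg1.
Qed.

Lemma mpolyX_sqnorm m :
  mpolyX R m * sqnorm = \sum_(i < n) mpolyX R (m +m (mnm1 i +m mnm1 i)).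
Proof. by rewrite mulr_sumr; apply: eq_bigr => i _; rewrite expr2 -!mpolyXD. Qed.

(* Homogenisation in degree [2k] through [1 = sqnorm]; it kills the monomials
   of odd degree, where a square root of [sqnorm] would be needed. *)
Definition homog (k : nat) (m : multinom n) : {mpoly R[n]} :=
  if odd (mdeg m) then 0 else sqnorm ^+ (k - (mdeg m)./2) * mpolyX R m.

(** The terms of [q] are sorted by the parity of their codegree [k - mdeg a]. Each is padded with
    [sqnorm] to the power half its codegree, rounded down. Products of terms of equal parity then
    assemble into two squares, and mixed products have odd degree and are killed. *)
Lemma sos_mlin_homog_sqr k q : deg_le q k -> sos (mlin (homog k) (q ^+ 2)).
Proof.
move=> qk; rewrite (mlin_sqr _ qk).
pose c (a : bmultinom n k.+1) := odd (k - mdeg a).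
pose g (N : {mpoly R[n]}) (a : bmultinom n k.+1) := q@_a *: (N ^+ (k - mdeg a)./2 * mpolyX R a).
have key N : \sum_(a : bmultinom n k.+1) \sum_(b : bmultinom n k.+1)
    (q@_a * q@_b) *: (if odd (mdeg (a +m b)) then 0
                      else N ^+ (k - (mdeg (a +m b))./2) * mpolyX R (a +m b)) =
    (\sum_(a | ~~ c a) g N a) ^+ 2 + N * (\sum_(a | c a) g N a) ^+ 2.
  rewrite (big_mkcond c) (big_mkcond (fun a => ~~ c a)) !expr2 !big_distrlr /=.
  rewrite mulr_sumr -big_split /=.
  apply: eq_bigr => a _; rewrite mulr_sumr -big_split /=; apply: eq_bigr => b _.
  rewrite mdegD.
have ha := bmdeg a; have hb := bmdeg b; rewrite !ltnS in ha hb.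
  have hodd : odd (mdeg a + mdeg b) = c a (+) c b.
    by rewrite /c !oddB // oddD; case: odd; case: odd; case: odd.
  have half2 (x : nat) : (x = odd x + x./2 * 2)%N by rewrite muln2 odd_double_half.
  rewrite hodd; case ca: (c a); case cb: (c b) => /=;
    rewrite ?scaler0 ?(mulr0, mul0r, addr0, add0r) //.
  (* For two odd codegrees, the two halves lost in rounding make up the extra factor [N]. *)
  - have -> : (k - (mdeg a + mdeg b)./2 = 1 + (k - mdeg a)./2 + (k - mdeg b)./2)%N.
      have := half2 (k - mdeg a)%N; have := half2 (k - mdeg b)%N.
      have := half2 (mdeg a + mdeg b)%N; rewrite hodd ca cb -/(c a) -/(c b) ca cb /=; lia.
    rewrite /g !exprD expr1 mpolyXD.
    move: (N ^+ _) (N ^+ _) => x y.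
    rewrite -!scalerAl -!scalerAr scalerA.
    by congr (_ *: _); ring.
  - have -> : (k - (mdeg a + mdeg b)./2 = (k - mdeg a)./2 + (k - mdeg b)./2)%N.
      have := half2 (k - mdeg a)%N; have := half2 (k - mdeg b)%N.
      have := half2 (mdeg a + mdeg b)%N; rewrite hodd ca cb -/(c a) -/(c b) ca cb /=; lia.
    rewrite /g !exprD mpolyXD.
    move: (N ^+ _) (N ^+ _) => x y.
    rewrite -!scalerAl -!scalerAr scalerA.
    by congr (_ *: _); ring.
rewrite (key sqnorm).
by apply: sosD; [exact: sos_sqr|apply: sosM; [exact: sos_sqnorm|exact: sos_sqr]].
Qed.

Lemma sos_mlin_homog k p : sos p -> deg_le p (2 * k) -> sos (mlin (homog k) p).
Proof.
move=> [s ->] /deg_le_sum_sqr hs; rewrite linear_sum big_seq /=.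
by apply: sos_sum => q /hs; exact: sos_mlin_homog_sqr.
Qed.

Lemma mpolyX1_sqr (i : 'I_n) :
  'X_i ^+ 2 = mpolyX R (mnm1 i +m mnm1 i) :> {mpoly R[n]}.
Proof. by rewrite expr2 -mpolyXD. Qed.

(** Degrees add in a domain, and since [n] is positive the monomial [m], the square of a variable,
    gives the sphere polynomial degree at least 2. *)
Lemma deg_le_sphereM u k : (0 < n)%N ->
  deg_le (u * sphere_poly R n) k.+2 -> deg_le u k.
Proof.
move=> n0; have [->|u0] := eqVneq u 0; first by rewrite deg_le0.
pose i0 : 'I_n := Ordinal n0; pose m := mnm1 i0 +m mnm1 i0.
have mE (i : 'I_n) : (mnm1 i +m mnm1 i == m) = (i == i0).
  apply/eqP/eqP => [/mnmP/(_ i0)|-> //].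
  by rewrite !mnmDE !mnm1E eqxx; case: eqP.
have hm : m \in msupp (sphere_poly R n).
  rewrite mcoeff_msupp /sphere_poly mcoeffB mcoeff1 raddf_sum /= (bigD1 i0) //=.
  rewrite mpolyX1_sqr mcoeffX mE eqxx big1 => [|i /negbTE ii0].
    by rewrite -mdeg_eq0 mdegD mdeg1 /= sub0r addr0 oppr_eq0 oner_eq0.
  by rewrite mpolyX1_sqr mcoeffX mE ii0.
have s0 : sphere_poly R n != 0 by apply: contraTneq hm => ->; rewrite msupp0.
rewrite /deg_le msizeM //; have := msize_mdeg_lt hm; rewrite mdegD mdeg1.
have : (0 < msize u)%N by rewrite lt0n msize_poly_eq0.
have aux (a b : nat) : (0 < a -> 2 < b -> (a + b).-1 <= k.+3 -> a <= k.+1)%N by lia.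
exact: aux.
Qed.

(** For a monomial [m] of [u], homogenising [m * sqnorm] uses one factor [sqnorm] less than
    homogenising [m], so the results agree. The degree bound on [u] keeps the truncated subtraction
    in the exponent exact. *)
Lemma mlin_homog_sphereM u k : (0 < n)%N ->
  deg_le (u * sphere_poly R n) (2 * k.+1) ->
  mlin (homog k.+1) (u * sphere_poly R n) = 0.
Proof.
rewrite mulnS => n0 /(deg_le_sphereM n0) /deg_leP hu.
rewrite {1}(mpolyE u) mulr_suml linear_sum big_seq big1 //= => m /hu dm.
rewrite -scalerAl linearZ /= /sphere_poly -/sqnorm mulrBr mulr1 mpolyX_sqnorm.
rewrite linearB /= mlinX [mlin _ _]linear_sum /=.
have e i : mlin (homog k.+1) (mpolyX R (m +m (mnm1 i +m mnm1 i))) =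
    if odd (mdeg m) then 0
    else sqnorm ^+ (k.+1 - (mdeg m)./2.+1) * mpolyX R m * 'X_i ^+ 2.
  by rewrite mlinX /homog !mdegD mdeg1 addn2 /= negbK mpolyXD -mpolyX1_sqr mulrA.
rewrite (eq_bigr _ (fun i _ => e i)) /homog.
case: ifP => _; first by rewrite big1 // subrr scaler0.
have -> : (k.+1 - (mdeg m)./2 = (k.+1 - (mdeg m)./2.+1).+1)%N by lia.
by rewrite -mulr_sumr -/sqnorm exprSr mulrAC subrr scaler0.
Qed.

Lemma mlin_homogC k c : mlin (homog k) (c%:MP) = c *: sqnorm ^+ k.
Proof.
rewrite -[c%:MP]mulr1 mul_mpolyC linearZ -mpolyX0 /= mlinX /homog mdeg0 /=.
by rewrite subn0 mpolyX0 mulr1.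
Qed.

Lemma mlin_homog_mono k (m : multinom n) d :
  mdeg m = (2 * d)%N -> mlin (homog k) (mpolyX R m) = sqnorm ^+ (k - d) * mpolyX R m.
Proof.
by move=> dm; rewrite mlinX /homog dm mul2n odd_double half_double.
Qed.

End Homogenise.

(** * Parts that are even in every variable *)

Section Parity.
Context (R : realType) (n : nat).
Implicit Types (p q u : {mpoly R[n]}) (m : multinom n) (S : {set 'I_n}).

Definition half_mnm m : multinom n := Multinom [tuple (m i)./2 | i < n].

Definition odd_supp m : {set 'I_n} := [set i | odd (m i)].

Definition set_mnm S : multinom n := Multinom [tuple nat_of_bool (i \in S) | i < n].

(* The linear map sending [p] to the polynomial [p'] such that [p'(x_1^2, .., x_n^2)]
   is the part of [p] that is even in each variable. *)
Definition even_part m : {mpoly R[n]} :=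
  if odd_supp m == finset.set0 then mpolyX R (half_mnm m) else 0.

Lemma half_mnmE m i : half_mnm m i = (m i)./2.
Proof. exact: mnmE. Qed.

Lemma set_mnmE S i : set_mnm S i = (i \in S).
Proof. exact: mnmE. Qed.

Lemma set_mnmX S : \prod_(j in S) 'X_j = mpolyX R (set_mnm S).
Proof.
rewrite mpolyXE_id big_mkcond; apply: eq_bigr => i _.
by rewrite set_mnmE; case: (i \in S); rewrite ?expr1 ?expr0.
Qed.

Lemma odd_suppD m1 m2 :
  (odd_supp (m1 +m m2) == finset.set0) = (odd_supp m1 == odd_supp m2).
Proof.
apply/eqP/eqP => [/setP h|/setP h]; apply/setP => i; move: (h i);
  by rewrite !inE mnmDE oddD; case: odd; case: odd.
Qed.

Lemma half_mnmD m1 m2 : odd_supp m1 = odd_supp m2 ->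
  half_mnm (m1 +m m2) = set_mnm (odd_supp m1) +m (half_mnm m1 +m half_mnm m2).
Proof.
move=> /setP h; apply/mnmP => i; rewrite !mnmDE !half_mnmE mnmDE set_mnmE.
by move: (h i); rewrite !inE halfD => ->; case: odd.
Qed.

Lemma mdeg_half m : (mdeg (set_mnm (odd_supp m)) + 2 * mdeg (half_mnm m) = mdeg m)%N.
Proof.
rewrite !mdegE big_distrr -big_split; apply: eq_bigr => i _ /=.
by rewrite set_mnmE half_mnmE inE mul2n odd_double_half.
Qed.

(** When [msize q <= k], these are the polynomials q_S such that q is the sum over S of x^S
    q_S(x_1^2, .., x_n^2). *)
Definition parity_class k q S : {mpoly R[n]} :=
  \sum_(a : bmultinom n k | odd_supp a == S) q@_a *: mpolyX R (half_mnm a).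

(** By [odd_suppD], a product of two monomials is even in every variable exactly when their odd
    supports agree. If both equal S, halving the product leaves one factor x^S, by [half_mnmD]. *)
Lemma mlin_even_part_sqr k q : (msize q <= k)%N ->
  mlin even_part (q ^+ 2) =
  \sum_(S : {set 'I_n}) parity_class k q S ^+ 2 * \prod_(j in S) 'X_j.
Proof.
move=> qk; rewrite (mlin_sqr _ qk).
have sqE S : parity_class k q S ^+ 2 * \prod_(j in S) 'X_j =
    \sum_(a : bmultinom n k) \sum_(b : bmultinom n k)
      if (odd_supp a == S) && (odd_supp b == S)
      then (q@_a * q@_b) *: mpolyX R (half_mnm (a +m b)) else 0.
  rewrite set_mnmX expr2 /parity_class big_mkcond big_distrlr mulr_suml.
  apply: eq_bigr => a _; rewrite mulr_suml; apply: eq_bigr => b _ /=.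
  case: eqP => [ha|_]; last by rewrite !mul0r.
  case: eqP => [hb|_]; last by rewrite mulr0 mul0r.
  rewrite half_mnmD ?ha ?hb //= !mpolyXD -!scalerAl -!scalerAr -scalerAl scalerA.
  by congr (_ *: _); ring.
rewrite (eq_bigr _ (fun S _ => sqE S)) [RHS]exchange_big /=; apply: eq_bigr => a _.
rewrite [RHS]exchange_big /=; apply: eq_bigr => b _.
rewrite (bigD1 (odd_supp a)) //= eqxx /= big1 => [|S /negbTE hS]; last first.
  by rewrite eq_sym hS.
rewrite addr0 /even_part odd_suppD eq_sym.
by case: eqP => // _; rewrite scaler0.
Qed.

(** By [mdeg_half], twice the degree of each term is the sum of the degrees of two monomials of [q],
    both at most [k]. *)
Lemma deg_le_parity_class k q S :
  deg_le (parity_class k.+1 q S ^+ 2 * \prod_(j in S) 'X_j) k.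
Proof.
rewrite set_mnmX expr2 /parity_class -mulrA mulr_suml.
apply: deg_le_sum => a /eqP ha; rewrite mulr_suml mulr_sumr.
apply: deg_le_sum => b /eqP hb.
apply: (@deg_leW _ _ _ (mdeg (half_mnm a) + (mdeg (half_mnm b) + mdeg (set_mnm S)))).
  have := mdeg_half a; have := mdeg_half b; rewrite ha hb.
  have := bmdeg a; have := bmdeg b; lia.
by do 2?apply: deg_leM; rewrite ?deg_leX //; apply: deg_leZ; exact: deg_leX.
Qed.

(** A factor x_i^2 leaves all parities unchanged and adds one to the i-th halved exponent. *)
Lemma mlin_even_partM_sqr u (i : 'I_n) :
  mlin even_part (u * 'X_i ^+ 2) = mlin even_part u * 'X_i.
Proof.
rewrite {1 2}(mpolyE u) mulr_suml !linear_sum mulr_suml; apply: eq_bigr => m _.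
rewrite -!scalerAl !linearZ -scalerAl /=; congr (_ *: _).
rewrite mpolyX1_sqr -mpolyXD !mlinX /even_part.
have os2 : odd_supp (mnm1 i +m mnm1 i) = finset.set0.
  by apply/eqP; rewrite odd_suppD.
have -> : (odd_supp (m +m (mnm1 i +m mnm1 i)) == finset.set0) = (odd_supp m == finset.set0).
  by rewrite odd_suppD os2.
case: eqP => [hm|_]; last by rewrite mul0r.
rewrite -mpolyXD; congr (mpolyX _ _); apply/mnmP => j.
by rewrite half_mnmE !mnmDE half_mnmE addnn halfD odd_double andbF half_double.
Qed.

Lemma mlin_even_part_sphereM u :
  mlin even_part (u * sphere_poly R n) = mlin even_part u * simplex_poly R n.
Proof.
rewrite /sphere_poly /simplex_poly !mulrBr !mulr1 linearB /= mulr_sumr mulr_sumr.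
rewrite [mlin _ (\sum_(i < n) _)]linear_sum.
by congr (_ - _); apply: eq_bigr => i _; exact: mlin_even_partM_sqr.
Qed.

Lemma mlin_even_partC c : mlin even_part (c%:MP) = c%:MP.
Proof.
rewrite -[c%:MP]mulr1 mul_mpolyC linearZ -mpolyX0 /= mlinX /even_part.
have -> : odd_supp (@mnm0 n) = finset.set0 by apply/setP => i; rewrite !inE mnm0E.
by rewrite eqxx; congr (_ *: mpolyX _ _); apply/mnmP => i; rewrite half_mnmE mnm0E.
Qed.

Lemma mlin_even_part_sqr2 (i j : 'I_n) :
  mlin even_part ('X_i ^+ 2 * 'X_j ^+ 2) = 'X_i * 'X_j.
Proof.
by rewrite mlin_even_partM_sqr -[X in mlin _ X]mul1r mlin_even_partM_sqr
  -mpolyC1 mlin_even_partC mpolyC1 mul1r.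
Qed.

Lemma deg_le_mlin_even_part p d :
  deg_le p (2 * d) -> deg_le (mlin even_part p) d.
Proof.
move=> /deg_leP hp; rewrite /mlin big_seq; apply: deg_le_sum => m /hp dm.
apply: deg_leZ; rewrite /even_part; case: eqP => _; last exact: deg_le0.
apply: deg_leW (deg_leX _ _); have := mdeg_half m; lia.
Qed.

End Parity.

(** * Truncated preorderings and the substitution of squares *)

Section Cones.
Context (R : realType) (n : nat).
Implicit Types (p q u : {mpoly R[n]}).

Lemma preord_truncD r p q :
  preord_trunc r p -> preord_trunc r q -> preord_trunc r (p + q).
Proof.
move=> [a [ha ->]] [b [hb ->]]; exists (fun S => a S + b S); split.
  move=> S; have [[sa da] [sb db]] := (ha S, hb S).
  by split; [exact: sosD|rewrite mulrDl deg_leD].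
by rewrite -big_split; apply: eq_bigr => S _; rewrite mulrDl.
Qed.

Lemma preord_trunc_mono r p (S : {set 'I_n}) :
  sos p -> deg_le (p * \prod_(j in S) 'X_j) (2 * r) ->
  preord_trunc r (p * \prod_(j in S) 'X_j).
Proof.
move=> sp dp; exists (fun T => if T == S then p else 0); split.
  by move=> T; case: eqP => [->//|_]; rewrite mul0r; split; [exact: sos0|exact: deg_le0].
by rewrite (bigD1 S) //= eqxx [X in _ + X]big1 ?addr0 // => T /negbTE ->; rewrite mul0r.
Qed.

Lemma preord_trunc_sum r (I : Type) (s : seq I) (P : pred I) (F : I -> {mpoly R[n]}) :
  (forall i, P i -> preord_trunc r (F i)) ->
  preord_trunc r (\sum_(i <- s | P i) F i).
Proof.
move=> h; elim/big_ind: _ => //; last exact: preord_truncD.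
exists (fun=> 0); split; last by rewrite big1 // => S _; rewrite mul0r.
by move=> S; rewrite mul0r; split; [exact: sos0|exact: deg_le0].
Qed.

Lemma preord_trunc_qmodule r p : qmodule_trunc r p -> preord_trunc r p.
Proof.
move=> [s0 [s [hs0 ds0 hs ->]]]; apply: preord_truncD.
  have e : s0 = s0 * \prod_(j in (finset.set0 : {set 'I_n})) 'X_j.
    by rewrite big_set0 mulr1.
  by rewrite e; apply: preord_trunc_mono; rewrite -?e.
apply: preord_trunc_sum => j _; have [sj dj] := hs j.
by have := @preord_trunc_mono r _ [set j]%SET sj; rewrite big_set1; exact.
Qed.

Lemma preord_trunc_mlin_even_part r p : sos p -> deg_le p (2 * (2 * r)) ->
  preord_trunc r (mlin (@even_part R n) p).
Proof.
move=> [s ->] /deg_le_sum_sqr hs; rewrite linear_sum big_seq /=.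
apply: preord_trunc_sum => q /hs dq; rewrite (mlin_even_part_sqr dq).
apply: preord_trunc_sum => S _; apply: preord_trunc_mono; first exact: sos_sqr.
exact: deg_le_parity_class.
Qed.

(** [FG R e] is convertible to [sqr_subst (fG R e)]; the separate name carries the ring morphism
    structure. *)
Definition sqr_subst (p : {mpoly R[n]}) : {mpoly R[n]} :=
  comp_mpoly [tuple 'X_i ^+ 2 | i < n] p.

HB.instance Definition _ := GRing.LRMorphism.copy sqr_subst
  (comp_mpoly [tuple ('X_i : {mpoly R[n]}) ^+ 2 | i < n]).

Lemma sqr_substX (i : 'I_n) : sqr_subst 'X_i = 'X_i ^+ 2.
Proof. by rewrite /sqr_subst comp_mpolyXU -tnth_nth tnth_mktuple. Qed.

Lemma sos_sqr_subst p : sos p -> sos (sqr_subst p).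
Proof.
move=> [s ->]; rewrite rmorph_sum; apply: sos_sum => q _.
by rewrite rmorphXn; exact: sos_sqr.
Qed.

Lemma deg_le_sqr_subst p d : deg_le p d -> deg_le (sqr_subst p) (2 * d).
Proof.
move=> /deg_leP hp; rewrite /sqr_subst comp_mpolyEX big_seq.
apply: deg_le_sum => m /hp dm; apply: deg_leZ; rewrite comp_mpolyX.
have -> : \prod_(i < n) tnth [tuple ('X_i : {mpoly R[n]}) ^+ 2 | i < n] i ^+ m i
        = mpolyX R (m +m m).
  rewrite mpolyXE_id; apply: eq_bigr => i _.
  by rewrite tnth_mktuple -exprM mnmDE mul2n addnn.
by apply: deg_leW (deg_leX _ _); rewrite mdegD addnn -mul2n leq_mul2l dm.
Qed.

Lemma sqr_subst_simplex : sqr_subst (simplex_poly R n) = sphere_poly R n.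
Proof.
rewrite /simplex_poly /sphere_poly rmorphB rmorph1 rmorph_sum.
by congr (_ - _); apply: eq_bigr => i _; exact: sqr_substX.
Qed.

(** Each product of variables becomes the square of that product. *)
Lemma sos_sqr_subst_preord r p : preord_trunc r p ->
  sos_trunc (2 * r) (sqr_subst p).
Proof.
move=> [s [hs ->]]; split; last first.
  apply: deg_le_sqr_subst; apply: deg_le_sum => S _; exact: (hs S).2.
rewrite rmorph_sum; apply: sos_sum => S _; rewrite rmorphM rmorph_prod.
apply: sosM; first exact: sos_sqr_subst (hs S).1.
rewrite (eq_bigr (fun j : 'I_n => 'X_j ^+ 2)) => [|j _]; last exact: sqr_substX.
by rewrite prodrXl; exact: sos_sqr.
Qed.

End Cones.

(** * Closedness of the cone of sums of squares *)

Section PositiveForms.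
Context (R : realType) (T : finType).
Implicit Types (G : T -> T -> R) (c : T -> R).

Definition qform G c : R := \sum_a \sum_b G a b * (c a * c b).

Lemma sum_delta (F : T -> R) x : \sum_a F a * (a == x)%:R = F x.
Proof.
rewrite (bigD1 x) //= eqxx mulr1 big1 ?addr0 // => a /negbTE ->.
by rewrite mulr0.
Qed.

(** For a positive semidefinite form, this quadratic in [s] is nonnegative; [psd_sos] uses it at
    well-chosen values of [s]. *)
Lemma qformD_delta G c x s : (forall a b, G a b = G b a) ->
  qform G (fun a => c a + s * (a == x)%:R) =
  qform G c + s * (\sum_b G x b * c b) *+ 2 + s ^+ 2 * G x x.
Proof.
move=> Gsym; rewrite /qform.
have e a : \sum_b G a b * ((c a + s * (a == x)%:R) * (c b + s * (b == x)%:R)) =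
    \sum_b G a b * (c a * c b) + s * (G x a * c a)
    + (s * (\sum_b G a b * c b) + s ^+ 2 * G a x) * (a == x)%:R.
  have -> : s * (G x a * c a) = \sum_b s * (G a b * c a) * (b == x)%:R.
    by rewrite sum_delta Gsym.
  have -> : s ^+ 2 * G a x = \sum_b s ^+ 2 * G a b * (b == x)%:R by rewrite sum_delta.
  rewrite mulr_sumr -!big_split mulr_suml -big_split; apply: eq_bigr => b _ /=.
  ring.
rewrite (eq_bigr _ (fun a _ => e a)) !big_split /= sum_delta -mulr_sumr mulr2n.
by rewrite !addrA.
Qed.

(** Completing squares, by induction on the size of a set [A] outside which the rows vanish. A zero
    pivot forces its whole row to vanish; a positive one splits off a square and leaves the Schur
    complement [H']. *)
Lemma psd_sos (n : nat) G (v : T -> {mpoly R[n]}) :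
  (forall a b, G a b = G b a) -> (forall c, 0 <= qform G c) ->
  sos (\sum_a \sum_b G a b *: (v a * v b)).
Proof.
suff main k : forall (A : {set T}) H, (#|A| <= k)%N ->
    (forall a b, a \notin A -> H a b = 0) ->
    (forall a b, H a b = H b a) -> (forall c, 0 <= qform H c) ->
    sos (\sum_a \sum_b H a b *: (v a * v b)).
  by apply: (main #|T| [set: T]%SET) => [|a b]; rewrite ?cardsT // inE.
elim: k => [|k ih] A H.
  rewrite leqn0 cards_eq0 => /eqP -> H0 _ _; rewrite big1 => [|a _]; first exact: sos0.
  by rewrite big1 // => b _; rewrite H0 ?inE // scale0r.
case: (set_0Vmem A) => [->|[x xA]] cA HA Hsym Hpsd.
  by apply: (ih finset.set0 H) => //; rewrite ?cards0 // => a b; apply: HA.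
have cAx : (#|A :\ x| <= k)%N by move: cA; rewrite (cardsD1 x) xA.
have Hx c s : 0 <= qform H c + s * (\sum_b H x b * c b) *+ 2 + s ^+ 2 * H x x.
  by rewrite -qformD_delta.
have q0 : qform H (fun=> 0) = 0.
  by rewrite /qform big1 // => a _; rewrite big1 // => b _; rewrite !mulr0.
have Hxx : 0 <= H x x.
  have := Hx (fun=> 0) 1; rewrite q0 big1 => [|b _]; last by rewrite mulr0.
  by rewrite mulr0 mul0rn addr0 add0r expr1n mul1r.
have [Hxx0|Hxx_neq0] := eqVneq (H x x) 0.
  suff Hx0 b : H x b = 0.
    apply: (ih (A :\ x)%SET) => // a b; rewrite !inE negb_and negbK.
    by case/orP => [/eqP ->//|/HA].
  apply/eqP/negPn/negP => Hxb.
  (* This choice of [s] would give the form the value -1. *)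
  have := Hx (fun a => (a == b)%:R) (- (H b b + 1) / (H x b *+ 2)).
  rewrite sum_delta Hxx0 mulr0 addr0.
  have -> : qform H (fun a => (a == b)%:R) = H b b.
    rewrite /qform -[RHS](sum_delta (fun a => H a b)); apply: eq_bigr => a _.
    by rewrite -(sum_delta (fun d => H a d * (a == b)%:R)); apply: eq_bigr => d _; rewrite mulrA.
  have -> : - (H b b + 1) / (H x b *+ 2) * H x b *+ 2 = - (H b b + 1).
    by field.
  lra.
have Hxx_gt0 : 0 < H x x by rewrite lt_def Hxx_neq0.
pose H' a b := H a b - H x a * H x b / H x x.
have -> : \sum_a \sum_b H a b *: (v a * v b) =
    \sum_a \sum_b H' a b *: (v a * v b)
    + (H x x)^-1 *: (\sum_a H x a *: v a) ^+ 2.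
  rewrite expr2 big_distrlr scaler_sumr -big_split; apply: eq_bigr => a _ /=.
  rewrite scaler_sumr -big_split; apply: eq_bigr => b _ /=.
  rewrite -scalerAl -scalerAr !scalerA -scalerDl; congr (_ *: _).
  by rewrite /H'; field.
apply: sosD; last by apply: sosZ; [rewrite invr_ge0|exact: sos_sqr].
apply: (ih (A :\ x)%SET) => //.
- move=> a b; rewrite !inE negb_and negbK /H' => /orP[/eqP ->|/HA h].
    by field.
  by rewrite h Hsym h !mul0r subr0.
- by move=> a b; rewrite /H' Hsym [H x b * _]mulrC.
- move=> c; pose t := \sum_b H x b * c b.
  have -> : qform H' c = qform H c - t ^+ 2 / H x x.
    rewrite /t expr2 big_distrlr mulr_suml /qform -sumrB; apply: eq_bigr => a _.
    rewrite mulr_suml -sumrB; apply: eq_bigr => b _ /=.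
    by rewrite /H'; ring.
  (* This [s] minimises the quadratic, and the minimum is the value of the Schur complement at
     [c]. *)
  have := Hx c (- t / H x x); rewrite -/t.
  by congr (0 <= _); field.
Qed.

End PositiveForms.

(** * A moment functional bounding the coefficients of squares *)

Section Closedness.
Context (R : realType) (n d : nat).
Implicit Types (p q : {mpoly R[n]}) (m : multinom n).

Definition mnm_sq m : nat := \sum_(i < n) m i ^ 2.

(** By the parallelogram law the gap is the squared distance of [m1] and [m2]. Being a positive
    integer, it yields a full factor [base] for off-diagonal moments. *)
Lemma mnm_sqD m1 m2 : m1 != m2 ->
  (mnm_sq (m1 +m m2) < 2 * mnm_sq m1 + 2 * mnm_sq m2)%N.
Proof.
move=> m12; rewrite /mnm_sq !big_distrr -big_split /=.
have [i mi] : exists i, m1 i != m2 i.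
  apply/existsP; apply: contraNT m12 => /existsPn h.
  by apply/eqP/mnmP => i; apply/eqP/negPn.
rewrite (bigD1 i) //= [X in (_ < X)%N](bigD1 i) //= -addSn.
apply: leq_add; last first.
  apply: leq_sum => j _; rewrite mnmDE sqrnD.
  by have := (nat_Cauchy (m1 j) (m2 j)).1; lia.
rewrite mnmDE sqrnD; have [le_i eq_i] := nat_Cauchy (m1 i) (m2 i).
have : (2 * (m1 i * m2 i) < m1 i ^ 2 + m2 i ^ 2)%N by rewrite ltn_neqAle eq_i mi.
lia.
Qed.

Lemma mnm_sq_double m : mnm_sq (m +m m) = (4 * mnm_sq m)%N.
Proof.
by rewrite /mnm_sq big_distrr; apply: eq_bigr => i _; rewrite mnmDE addnn -mul2n expnMn.
Qed.

Local Notation T := (bmultinom n d.+1).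
(** Chosen so that the off-diagonal terms cost at most half of the diagonal sum. *)
Let base : R := (2 * #|{: T}|)%:R.

(* A functional that is positive on squares: the moments grow so fast that the
   moment matrix is diagonally dominant after rescaling by [base ^+ (2 * mnm_sq a)]. *)
Definition moment m : R^o := base ^+ mnm_sq m.

Let base_ge2 : 2 <= base.
Proof.
rewrite ler_nat leq_pmulr //; apply/card_gt0P; exists (@bm0 n d); exact: isT.
Qed.

(** In the rescaled coefficients [z a] the diagonal terms are exactly [z a ^+ 2], and an
    off-diagonal term has absolute value at most (z_a^2 + z_b^2) / (2 base). Summing bounds the
    functional below by [Z / 2]. *)
Lemma sum_sqr_le_moment q : deg_le q d ->
  \sum_(a : T) q@_a ^+ 2 <= mlin moment (q ^+ 2) *+ 2.
Proof.
move=> qd; rewrite (mlin_sqr _ qd).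
have b0 : 0 < base by have := base_ge2; lra.
have b1 : 1 <= base by have := base_ge2; lra.
pose z (a : T) := q@_a * base ^+ (2 * mnm_sq a).
have hz (a : T) : q@_a ^+ 2 <= z a ^+ 2.
  rewrite /z exprMn ler_peMr ?sqr_ge0 // -exprM.
  by rewrite exprn_ege1.
have hzz (a b : T) :
    z a ^+ 2 * (b == a)%:R - (z a ^+ 2 + z b ^+ 2) / (base *+ 2) <=
    (q@_a * q@_b) *: moment (a +m b).
  have zab0 : 0 <= (z a ^+ 2 + z b ^+ 2) / (base *+ 2).
    by rewrite divr_ge0 ?addr_ge0 ?sqr_ge0 // mulrn_wge0 // ltW.
  have [->|ba] := eqVneq b a.
    rewrite mulr1 /moment mnm_sq_double.
    have -> : (q@_a * q@_a) *: (base ^+ (4 * mnm_sq a) : R^o) = z a ^+ 2.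
      by rewrite /z exprMn -exprM mulnAC expr2.
    by rewrite gerBl; rewrite divr_ge0 ?addr_ge0 ?sqr_ge0 // mulrn_wge0 // ltW.
  rewrite mulr0 sub0r.
  have ab : (a : multinom n) != b by rewrite eq_sym; exact: ba.
  have := mnm_sqD ab; set s := mnm_sq _ => hs.
  have hw : base * moment (a +m b) <= base ^+ (2 * mnm_sq a) * base ^+ (2 * mnm_sq b).
    by rewrite -exprD -exprS; exact: ler_weXn2l.
  have m0 : 0 <= moment (a +m b) by rewrite exprn_ge0 // ltW.
  rewrite -lerN2 opprK.
  apply: le_trans (_ : `|q@_a * q@_b| * moment (a +m b) <= _).
    rewrite -[leLHS]/(- ((q@_a * q@_b) * moment (a +m b))) -mulNr.
    by rewrite ler_wpM2r // -normrN ler_norm.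
  have b20 : 0 < base *+ 2 by lra.
  rewrite ler_pdivlMr //.
  have -> : `|q@_a * q@_b| * moment (a +m b) * (base *+ 2) =
            `|q@_a * q@_b| * (base * moment (a +m b)) *+ 2 by ring.
  apply: le_trans (_ : `|z a * z b| *+ 2 <= _).
    rewrite lerMn2r /= /z.
    have -> : `|q@_a * base ^+ (2 * mnm_sq a) * (q@_b * base ^+ (2 * mnm_sq b))| =
      `|q@_a * q@_b| * (base ^+ (2 * mnm_sq a) * base ^+ (2 * mnm_sq b)).
      rewrite mulrACA [LHS]normrM; congr (_ * _).
      by rewrite ger0_norm // mulr_ge0 // exprn_ge0 // ltW.
    by rewrite ler_wpM2l.
  rewrite -normrMn real_ler_norml ?num_real //; apply/andP; split.
    by have := sqr_ge0 (z a + z b); rewrite sqrrD; lra.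
  by have := sqr_ge0 (z a - z b); rewrite sqrrB; lra.
have : \sum_a \sum_b (z a ^+ 2 * (b == a)%:R - (z a ^+ 2 + z b ^+ 2) / (base *+ 2))
    <= \sum_(a : T) \sum_(b : T) (q@_a * q@_b) *: moment (a +m b).
  by apply: ler_sum => i _; apply: ler_sum => j _.
set Z := \sum_(a : T) z a ^+ 2.
have -> : \sum_a \sum_b (z a ^+ 2 * (b == a)%:R - (z a ^+ 2 + z b ^+ 2) / (base *+ 2))
    = Z / 2.
  have e (a : T) :
      \sum_b (z a ^+ 2 * (b == a)%:R - (z a ^+ 2 + z b ^+ 2) / (base *+ 2)) =
      z a ^+ 2 - (z a ^+ 2 *+ #|{: T}| + Z) / (base *+ 2).
    rewrite sumrB (sum_delta (fun=> z a ^+ 2)) -mulr_suml big_split /=.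
    by rewrite sumr_const.
  rewrite (eq_bigr _ (fun a _ => e a)) sumrB -mulr_suml big_split /= sumr_const.
  rewrite sumrMnl -/Z.
  have -> : (Z *+ #|{: T}| + Z *+ #|{: T}|) / (base *+ 2) = Z / 2.
    rewrite -!(mulr_natr Z) /base natrM; field.
    by apply: contraTneq b0 => T0; rewrite /base natrM T0 mulr0 ltxx.
  by field.
move=> h.
apply: (@le_trans _ _ Z); first exact: ler_sum.
by move: h; rewrite -/Z; lra.
Qed.

End Closedness.

(** * Gram matrices *)

Section Gram.
Context (R : realType) (n d : nat).
Implicit Types (p q : {mpoly R[n]}) (m : multinom n).
Local Notation T := (bmultinom n d.+1).

Definition is_gram (G : T -> T -> R) p : Prop :=
  [/\ forall a b, G a b = G b a, forall c, 0 <= qform G c &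
      forall m, p@_m = \sum_a \sum_b G a b * (a +m b == m)%:R].

(** The Gram matrix is the sum of the rank-one matrices of the roots; its entries are bounded by its
    trace, hence by the functional. As this bound is linear in [p], it is uniform along a segment of
    polynomials. *)
Lemma sos_gram p : sos p -> deg_le p (2 * d) ->
  exists2 G, is_gram G p &
    forall a b, `|G a b| <= mlin (moment R d) p *+ 2.
Proof.
move=> [s ->] /deg_le_sum_sqr hs; exists (fun a b : T => \sum_(q <- s) q@_a * q@_b).
  split.
  - by move=> a b; apply: eq_bigr => q _; rewrite mulrC.
  - move=> c; rewrite /qform.
    have -> : \sum_(a : T) \sum_(b : T) (\sum_(q <- s) q@_a * q@_b) * (c a * c b) =
              \sum_(q <- s) (\sum_(a : T) q@_a * c a) ^+ 2.
      rewrite [RHS](eq_bigr (fun q => \sum_(a : T) \sum_(b : T) (q@_a * q@_b) * (c a * c b))).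
        rewrite [RHS]exchange_big; apply: eq_bigr => a _; rewrite [RHS]exchange_big.
        by apply: eq_bigr => b _; rewrite mulr_suml.
      move=> q _; rewrite expr2 big_distrlr; apply: eq_bigr => a _.
      by apply: eq_bigr => b _ /=; rewrite mulrACA.
    by apply: sumr_ge0 => q _; exact: sqr_ge0.
  - move=> m; rewrite raddf_sum /= big_seq.
    rewrite (eq_bigr (fun q => \sum_(a : T) \sum_(b : T) (q@_a * q@_b) * (a +m b == m)%:R)).
      rewrite -big_seq exchange_big; apply: eq_bigr => a _; rewrite exchange_big.
      by apply: eq_bigr => b _; rewrite mulr_suml.
    move=> q /hs qd; rewrite {1}(mpolywE qd) expr2 big_distrlr raddf_sum /=.
    apply: eq_bigr => a _; rewrite raddf_sum; apply: eq_bigr => b _ /=.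
    by rewrite -scalerAl -scalerAr scalerA -mpolyXD mcoeffZ mcoeffX.
have hL : \sum_(q <- s) \sum_(a : T) q@_a ^+ 2 <=
    mlin (moment R d) (\sum_(q <- s) q ^+ 2) *+ 2.
  rewrite [mlin _ _]linear_sum -sumrMnl big_seq [leRHS]big_seq /=.
  by apply: ler_sum => q /hs; exact: sum_sqr_le_moment.
move=> a b; apply: le_trans hL; apply: le_trans (ler_norm_sum _ _ _) _.
apply: ler_sum => q _; have [<-|ab] := eqVneq a b.
  rewrite -expr2 ger0_norm ?sqr_ge0 // (bigD1 a) //= lerDl.
  by apply: sumr_ge0 => i _; exact: sqr_ge0.
rewrite (bigD1 a) //= (bigD1 b) 1?eq_sym //= addrA.
apply: (@le_trans _ _ (q@_a ^+ 2 + q@_b ^+ 2)); last first.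
  by rewrite lerDl; apply: sumr_ge0 => i _; exact: sqr_ge0.
rewrite real_ler_norml ?num_real //; apply/andP; split.
  by have := sqr_ge0 (q@_a + q@_b); have := sqr_ge0 (q@_a - q@_b);
     rewrite sqrrB sqrrD; lra.
by have := sqr_ge0 (q@_a + q@_b); have := sqr_ge0 (q@_a - q@_b);
   rewrite sqrrB sqrrD; lra.
Qed.

Lemma gram_sos G p : is_gram G p -> sos p.
Proof.
move=> [Gsym Gpsd hp].
suff -> : p = \sum_a \sum_b G a b *: (mpolyX R a * mpolyX R b) by exact: psd_sos.
apply/mpolyP => m; rewrite hp raddf_sum; apply: eq_bigr => a _ /=.
by rewrite raddf_sum; apply: eq_bigr => b _ /=; rewrite -mpolyXD mcoeffZ mcoeffX.
Qed.

End Gram.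

(** * Limits along an ultrafilter *)

Section Limit.
Import numFieldNormedType.Exports.
Local Open Scope classical_set_scope.

Lemma ultra_fmap (S T : Type) (f : S -> T) (U : set_system S) :
  UltraFilter U -> UltraFilter (f @ U).
Proof.
move=> UU; split=> [|G GG fG]; first exact: fmap_proper_filter.
apply/seteqP; split=> // A GA.
have [//|UA] := in_ultra_setVsetC (f @^-1` A) UU.
have GAc : G (~` A) by apply: fG.
have := filter_not_empty G; case; rewrite -(setICr A); exact: filterI.
Qed.

(** Compactness of the interval. One ultrafilter serves all matrix entries at once, so no successive
    subsequences have to be extracted. *)
Lemma ultra_bounded_cvg (R : realType) (S : Type) (U : set_system S) (f : S -> R) (C : R) :
  UltraFilter U -> (forall x, `|f x| <= C) -> cvg (f @ U).
Proof.
move=> UU fC.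
have UC : U (f @^-1` `[- C, C]).
  by apply: filterE => x; rewrite /= in_itv /= -ler_norml.
have : compact `[- C, C] by exact: segment_compact.
rewrite compact_ultra => cptC.
have [l [_ fl]] := cptC _ (ultra_fmap f UU) UC.
exact: cvgP fl.
Qed.

Context (R : realType) (n d : nat).

(** The Gram matrices of [p + eps k *: q] are bounded by [C] since [eps k <= 1]. Symmetry,
    positivity and the coefficient equations pass to their limit, a Gram matrix of [p]. *)
Lemma sos_closed (p q : {mpoly R[n]}) : deg_le p (2 * d) -> deg_le q (2 * d) ->
  (forall eps : R, 0 < eps -> sos (p + eps *: q)) -> sos p.
Proof.
move=> dp dq hs; pose eps (k : nat) : R := k.+1%:R^-1.
pose C := (`|mlin (moment R d) p| + `|mlin (moment R d) q|) *+ 2.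
have hG k : exists G, is_gram (d := d) G (p + eps k *: q) /\ forall a b, `|G a b| <= C.
  have eps_gt0 : 0 < eps k by rewrite invr_gt0.
  have [G gG bG] := sos_gram (hs (eps k) eps_gt0) (deg_leD dp (deg_leZ _ dq)).
  exists G; split => // a b; apply: le_trans (bG a b) _.
  rewrite /C lerMn2r /= linearD linearZ /=; apply: lerD; first exact: ler_norm.
  apply: le_trans (ler_norm _) _; rewrite normrM ler_piMl //.
  by rewrite ger0_norm ?invr_ge0 // invf_le1 // ler1n.
have [G hGG] := choice hG.
(* [U] refines the filter at infinity, so [eps] still tends to 0 along it. *)
have [U [UU sU]] := ultraFilterLemma (eventually_filter : ProperFilter \oo).
pose H a b := lim (G k a b @[k --> U]).
have cH a b : G k a b @[k --> U] --> H a b.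
  by apply: (ultra_bounded_cvg (C := C)) => k; apply: (hGG k).2.
have cQ (w : bmultinom n d.+1 -> bmultinom n d.+1 -> R) :
    \sum_a \sum_b G k a b * w a b @[k --> U] --> \sum_a \sum_b H a b * w a b.
  apply: cvg_big => [|a _]; first exact: add_continuous.
  apply: cvg_big => [|b _]; first exact: add_continuous.
  by apply: cvgM; [exact: cH|exact: cvg_cst].
apply: (@gram_sos _ _ d H); split.
- move=> a b; have e : (fun k => G k a b) = (fun k => G k b a).
    by apply/funext => k; have [[sym_k _ _] _] := hGG k; exact: sym_k.
  by rewrite /H e.
- move=> c; rewrite /qform; apply: cvgr_to_ge (cQ _) _.
  by apply: nearW => k; have [[_ psd_k _] _] := hGG k; exact: psd_k.
- move=> m; have := cQ (fun a b => (a +m b == m)%:R).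
  rewrite (_ : (fun k => _) = fun k => p@_m + eps k * q@_m); last first.
    apply/funext => k; case: (hGG k) => -[_ _ <- _].
    by rewrite mcoeffD mcoeffZ.
  move=> /cvg_lim <- //; apply/esym/cvg_lim => //.
  rewrite -[X in _ --> X]addr0 -[X in _ + X](mul0r q@_m).
  apply: cvgD; first exact: cvg_cst.
  apply: cvgM; last exact: cvg_cst.
  by move=> A /cvg_harmonic /sU.
Qed.

End Limit.

(** * The graph polynomials *)

Section Bounds.
Context (R : realType) (n : nat) (e : rel 'I_n).
Implicit Types (p q u : {mpoly R[n]}) (S : {set 'I_n}).

Local Notation N := (sqnorm R n).
Local Notation F := (FG R e).

Lemma FG_sum : F = \sum_(i < n) \sum_(j < n)
  (1%:M + adjmx R e) i j *: ('X_i ^+ 2 * 'X_j ^+ 2).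
Proof.
rewrite -[LHS]/(sqr_subst (fG R e)) /fG [LHS]linear_sum; apply: eq_bigr => i _ /=.
rewrite [LHS]linear_sum; apply: eq_bigr => j _ /=.
by rewrite linearZ rmorphM /= !sqr_substX.
Qed.

Lemma FGE : F = \sum_(i < n) 'X_i ^+ 4
  + \sum_(i < n) \sum_(j < n) (e i j)%:R *: ('X_i ^+ 2 * 'X_j ^+ 2).
Proof.
rewrite FG_sum -big_split; apply: eq_bigr => i _ /=.
rewrite (eq_bigr (fun j => (i == j)%:R *: ('X_i ^+ 2 * 'X_j ^+ 2)
   + (e i j)%:R *: ('X_i ^+ 2 * 'X_j ^+ 2))) => [|j _] /=; last first.
  by rewrite !mxE scalerDl.
rewrite big_split (bigD1 i) //= eqxx scale1r -exprD big1 ?addr0 // => j.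
by rewrite eq_sym => /negbTE ->; rewrite scale0r.
Qed.

Lemma deg_le_fG : deg_le (fG R e) 2.
Proof.
apply: deg_le_sum => i _; apply: deg_le_sum => j _; apply: deg_leZ.
by rewrite -mpolyXD; apply: deg_leW (deg_leX _ _); rewrite mdegD !mdeg1.
Qed.

Lemma deg_le_FG : deg_le F 4.
Proof. exact: (deg_le_sqr_subst deg_le_fG). Qed.

Lemma even_part_FG : mlin (@even_part R n) F = fG R e.
Proof.
rewrite FG_sum [LHS]linear_sum; apply: eq_bigr => i _ /=.
rewrite [LHS]linear_sum; apply: eq_bigr => j _ /=.
by rewrite linearZ /= mlin_even_part_sqr2.
Qed.

(** F_G is homogeneous of degree 4, so every monomial gets the same padding. *)
Lemma homog_FG r : mlin (@homog R n (r + 2)) F = N ^+ r * F.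
Proof.
have mono (i j : 'I_n) : mlin (@homog R n (r + 2)) ('X_i ^+ 2 * 'X_j ^+ 2) =
    N ^+ r * ('X_i ^+ 2 * 'X_j ^+ 2).
  rewrite !mpolyX1_sqr -mpolyXD (@mlin_homog_mono _ _ _ _ 2) ?addnK //.
  by rewrite !mdegD !mdeg1.
rewrite FG_sum [LHS]linear_sum [RHS]mulr_sumr; apply: eq_bigr => i _ /=.
rewrite [LHS]linear_sum [RHS]mulr_sumr; apply: eq_bigr => j _ /=.
by rewrite linearZ /= mono scalerAr.
Qed.

Lemma po_feasibleP r l :
  poly_sum (@preord_trunc R n r) (ideal_trunc (simplex_poly R n) (2 * r))
    (fG R e - l%:MP) <->
  poly_sum (@sos_trunc R n (2 * r)) (ideal_trunc (sphere_poly R n) (2 * (2 * r)))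
    (F - l%:MP).
Proof.
split=> [[a [b [ha [u [du ->]] hE]]]|[a [b [[sa da] [u [du ->]] hE]]]].
  exists (sqr_subst a), (sqr_subst (u * simplex_poly R n)); split.
  - exact: sos_sqr_subst_preord.
  - exists (sqr_subst u); rewrite -sqr_subst_simplex -rmorphM; split => //.
    exact: deg_le_sqr_subst.
  - by rewrite -rmorphD -hE rmorphB /= [sqr_subst l%:MP]comp_mpolyC.
exists (mlin (@even_part R n) a), (mlin (@even_part R n) (u * sphere_poly R n)); split.
- exact: preord_trunc_mlin_even_part.
- exists (mlin (@even_part R n) u); rewrite -mlin_even_part_sphereM; split => //.
  exact: deg_le_mlin_even_part.
- by rewrite -linearD -hE linearB /= even_part_FG mlin_even_partC.
Qed.

Lemma FG_feasibleP r l : (0 < n)%N ->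
  poly_sum (@sos_trunc R n (r + 2)) (ideal_trunc (sphere_poly R n) (2 * (r + 2)))
    (F - l%:MP) <->
  sos (N ^+ r * (F - l *: N ^+ 2)).
Proof.
move=> n0; split=> [[a [b [[sa da] [u [du ->]] hE]]]|hs].
  have := congr1 (mlin (@homog R n (r + 2))) hE.
  rewrite [LHS]linearB [RHS]linearD /= homog_FG mlin_homogC.
  rewrite addn2 in da du *; rewrite mlin_homog_sphereM // addr0.
  rewrite mulrBr -scalerAr -exprD addn2 => ->; exact: sos_mlin_homog.
have dN k : deg_le (N ^+ k) (2 * k).
  by rewrite mulnC; apply: deg_leXn; exact: deg_le_sqnorm.
have dF : deg_le (F - l%:MP) (2 * (r + 2)).
  rewrite deg_leD ?deg_leN ?deg_leC //; apply: deg_leW deg_le_FG; lia.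
have dP : deg_le (N ^+ r * (F - l *: N ^+ 2)) (2 * (r + 2)).
  rewrite mulnDr; apply: deg_leM (dN r) _; rewrite deg_leD ?deg_le_FG //.
  by rewrite deg_leN; apply: deg_leZ; exact: dN.
exists (N ^+ r * (F - l *: N ^+ 2)), (F - l%:MP - N ^+ r * (F - l *: N ^+ 2)).
split => //; last by rewrite [RHS]addrC subrK.
have sphE k : 1 - N ^+ k = (\sum_(i < k) N ^+ i) * sphere_poly R n.
  by rewrite -opprB subrX1 mulrC -mulrN opprB.
(* The difference equals F (1 - N^r) - l (1 - N^(r+2)); [sphE] divides each bracket by 1 - N. *)
exists (F * (\sum_(i < r) N ^+ i) - l *: \sum_(i < r + 2) N ^+ i).
have -> : (F * (\sum_(i < r) N ^+ i) - l *: \sum_(i < r + 2) N ^+ i) * sphere_poly R n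
    = F - l%:MP - N ^+ r * (F - l *: N ^+ 2).
  rewrite mulrBl -mulrA -scalerAl -!sphE exprD -mul_mpolyC -mul_mpolyC; ring.
by split=> //; rewrite deg_leD ?deg_leN.
Qed.

Lemma Kcone_varthetaP r s : ssrbool.symmetric e ->
  Kcone r (s *: (1%:M + adjmx R e) - const_mx 1) <->
  sos (N ^+ r * (s *: F - N ^+ 2)).
Proof.
move=> e_sym; rewrite /Kcone.
have -> : \sum_(i < n) \sum_(j < n)
    (s *: (1%:M + adjmx R e) - const_mx 1) i j *: ('X_i ^+ 2 * 'X_j ^+ 2)
    = s *: F - N ^+ 2 :> {mpoly R[n]}.
  rewrite [N ^+ 2]expr2 /sqnorm big_distrlr FG_sum.
  rewrite scaler_sumr -sumrB; apply: eq_bigr => i _ /=.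
  rewrite scaler_sumr -sumrB; apply: eq_bigr => j _ /=; rewrite scalerA.
  by rewrite ![in LHS]mxE scalerBl scale1r !mxE.
split=> [[]|] // hs; split=> //; apply/matrixP => i j.
by rewrite !mxE eq_sym e_sym.
Qed.

Lemma feasible_invP r s : 0 < s ->
  sos (N ^+ r * (s *: F - N ^+ 2)) <-> sos (N ^+ r * (F - s^-1 *: N ^+ 2)).
Proof.
move=> s0; have s_neq0 : s != 0 by rewrite gt_eqF.
split=> /sosZ h.
  have := h s^-1; rewrite scalerAr scalerBr scalerA mulVf // scale1r.
  by apply; rewrite invr_ge0 ltW.
have := h s; rewrite scalerAr scalerBr scalerA mulfV // scale1r.
by apply; rewrite ltW.
Qed.

Lemma feasible_le r l l' : l' <= l ->
  sos (N ^+ r * (F - l *: N ^+ 2)) -> sos (N ^+ r * (F - l' *: N ^+ 2)).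
Proof.
move=> ll' hs.
have -> : N ^+ r * (F - l' *: N ^+ 2) =
    N ^+ r * (F - l *: N ^+ 2) + (l - l') *: N ^+ (r + 2).
  by rewrite exprD -!mul_mpolyC mpolyCB; ring.
by apply: sosD => //; apply: sosZ; [rewrite subr_ge0|exact: sosX (sos_sqnorm _ _)].
Qed.

(** The Cauchy-Schwarz defect of n sum_i x_i^4 against N^2 is a sum of squared differences, and the
    edge terms are squares. This supplies the positive feasible value 1/n in [max_feasible]. *)
Lemma feasible_card r : sos (N ^+ (2 * r) * (n%:R *: F - N ^+ 2)).
Proof.
rewrite mulnC exprM; apply: sosM; first exact: sos_sqr.
have -> : n%:R *: F - N ^+ 2 =
    2^-1 *: (\sum_(i < n) \sum_(j < n) ('X_i ^+ 2 - 'X_j ^+ 2) ^+ 2) +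
    n%:R *: (\sum_(i < n) \sum_(j < n) (e i j)%:R *: ('X_i * 'X_j) ^+ 2).
  rewrite FGE scalerDr -addrAC; congr (_ + _); last first.
    by congr (_ *: _); apply: eq_bigr => i _; apply: eq_bigr => j _; rewrite exprMn.
  have -> : \sum_(i < n) \sum_(j < n) ('X_i ^+ 2 - 'X_j ^+ 2) ^+ 2 =
      (2 : R) *: (n%:R *: \sum_(i < n) 'X_i ^+ 4 - N ^+ 2) :> {mpoly R[n]}.
    have nE : n%:R *: \sum_(i < n) 'X_i ^+ 4 =
        \sum_(i < n) \sum_(j < n) 'X_i ^+ 4 :> {mpoly R[n]}.
      by rewrite scaler_sumr; apply: eq_bigr => i _; rewrite sumr_const card_ord scaler_nat.
    have nE' : n%:R *: \sum_(i < n) 'X_i ^+ 4 =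
        \sum_(i < n) \sum_(j < n) 'X_j ^+ 4 :> {mpoly R[n]}.
      by rewrite nE exchange_big.
    rewrite -[2]/(2%:R) scaler_nat mulr2n {1}nE nE'.
    rewrite /sqnorm expr2 big_distrlr /= -!sumrB -big_split.
    apply: eq_bigr => i _ /=; rewrite -!sumrB -big_split; apply: eq_bigr => j _ /=.
    ring.
  by rewrite scalerA mulVf ?scale1r // pnatr_eq0.
apply: sosD; apply: sosZ; rewrite ?invr_ge0 ?ler0n //.
  by apply: sos_sum => i _; apply: sos_sum => j _; exact: sos_sqr.
by apply: sos_sum => i _; apply: sos_sum => j _; apply: sosZ; [rewrite ler0n|exact: sos_sqr].
Qed.

(** At the indicator vector of S both N and F_G take the value |S|, as no edge term survives. *)
Lemma stable_le_feasible r s S : stable e S -> S != finset.set0 ->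
  sos (N ^+ (2 * r) * (s *: F - N ^+ 2)) -> #|S|%:R <= s.
Proof.
move=> stS S0 /(sos_meval_ge0 (fun i => (i \in S)%:R)).
have S_gt0 : (0 : R) < #|S|%:R by rewrite ltr0n card_gt0.
have NS : meval (fun i => (i \in S)%:R) N = #|S|%:R.
  rewrite raddf_sum -sum1_card natr_sum [RHS]big_mkcond /=; apply: eq_bigr => i _.
  by rewrite rmorphXn /= mevalXU; case: (i \in S); rewrite ?expr1n ?expr0n.
have FS : meval (fun i => (i \in S)%:R) F = #|S|%:R.
  rewrite FGE raddfD !raddf_sum /= [X in _ + X]big1 => [|i _]; last first.
    rewrite [LHS]raddf_sum /= big1 // => j _; rewrite mevalZ rmorphM !rmorphXn /= !mevalXU.
    case: (boolP (i \in S)) => iS; last by rewrite expr0n mul0r mulr0.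
    case: (boolP (j \in S)) => jS; last by rewrite expr0n !mulr0.
    move/forall_inP: stS => /(_ i iS) /forall_inP /(_ j jS) /negbTE ->.
    by rewrite mul0r.
  rewrite addr0 -sum1_card natr_sum [RHS]big_mkcond /=; apply: eq_bigr => i _.
  by rewrite rmorphXn /= mevalXU; case: (i \in S); rewrite ?expr1n ?expr0n.
rewrite rmorphM rmorphXn rmorphB /= mevalZ rmorphXn /= NS FS.
rewrite pmulr_rge0 ?exprn_gt0 // expr2 -mulrBl pmulr_lge0 //.
by rewrite subr_ge0.
Qed.

Lemma alpha_le_feasible r s : (0 < n)%N -> irreflexive e ->
  sos (N ^+ (2 * r) * (s *: F - N ^+ 2)) ->
  (0 < alpha e)%N /\ (alpha e)%:R <= s.
Proof.
move=> n0 e_irr hs; pose S0 := [set Ordinal n0]%SET.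
have stS0 : stable e S0.
  by apply/forall_inP => i /set1P ->; apply/forall_inP => j /set1P ->; rewrite e_irr.
have a0 : (0 < alpha e)%N.
  by apply: leq_trans (leq_bigmax_cond _ stS0); rewrite cards1.
split=> //; move: a0; rewrite /alpha (bigop.bigmax_eq_arg S0) //.
case: arg_maxnP => // S stS _ cS.
by apply: (stable_le_feasible (r := r) stS) => //; rewrite -card_gt0.
Qed.

End Bounds.

(** * Attainment of the optimum and the chain of bounds *)

Lemma ereal_sup_attained (R : realType) (A : R -> Prop) l :
  A l -> (forall x, A x -> x <= l) ->
  ereal_sup [set x%:E | x in [set x | A x]]%classic = l%:E.
Proof.
move=> Al ubl; apply/eqP; rewrite eq_le; apply/andP; split.
  by apply: ge_ereal_sup => _ [x Ax <-]; rewrite lee_fin ubl.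
by apply: ereal_sup_ubound; exists l.
Qed.

(** The feasible set contains 1/n and is bounded by 1, because a positive feasible l satisfies 1/l
    >= alpha >= 1. Its supremum is feasible by [sos_closed]: lowering l by eps adds eps N^(2r+2). *)
Lemma max_feasible (R : realType) (n : nat) (n_gt0 : (0 < n)%N)
    (e : rel 'I_n) (e_irr : irreflexive e) (r : nat) :
  let feasible (l : R) :=
    sos (sqnorm R n ^+ (2 * r) * (FG R e - l *: sqnorm R n ^+ 2)) in
  exists l : R, [/\ 0 < l, feasible l & forall l', feasible l' -> l' <= l].
Proof.
set feasible := fun l => _.
have n0 : (0 : R) < n%:R by rewrite ltr0n.
have fn : feasible n%:R^-1 by apply/(feasible_invP _ _ n0); exact: feasible_card.
have ub1 l : feasible l -> l <= 1.
  move=> fl; have [l0|/le_trans -> //] := ltP 0 l.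
  have : sos (sqnorm R n ^+ (2 * r) * (l^-1 *: FG R e - sqnorm R n ^+ 2)).
    by apply/feasible_invP; rewrite ?invr_gt0 // invrK.
  move=> /(alpha_le_feasible n_gt0 e_irr) [a0 /(le_trans _)] h.
  by rewrite -invf_ge1 //; apply: h; rewrite ler1n.
have hsup : has_sup [set l | feasible l]%classic.
  by split; [exists n%:R^-1|exists 1 => l; exact: ub1].
exists (sup [set l | feasible l]%classic); split.
- have : n%:R^-1 <= sup [set l | feasible l]%classic by apply: sup_upper_bound.
  by apply: lt_le_trans; rewrite invr_gt0.
- rewrite /feasible; set l0 := sup _.
  have dN k : deg_le (sqnorm R n ^+ k) (2 * k).
    by rewrite mulnC; apply: deg_leXn; exact: deg_le_sqnorm.
  apply: (@sos_closed _ _ (2 * r + 2) _ (sqnorm R n ^+ (2 * r + 2))).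
  + rewrite mulnDr; apply: deg_leM (dN _) _; rewrite deg_leD ?deg_le_FG //.
    by rewrite deg_leN; apply: deg_leZ; exact: dN.
  + exact: dN.
  move=> eps eps0; have [l fl lt_l] := sup_adherent eps0 hsup.
  have := feasible_le (ltW lt_l) fl; congr sos.
  by rewrite exprD -!mul_mpolyC mpolyCB; ring.
- by move=> l fl; apply: sup_upper_bound.
Qed.

Theorem corollary3p12 (R : realType) (n : nat) (n_gt0 : (0 < n)%N)
    (e : rel 'I_n) (e_sym : ssrbool.symmetric e) (e_irr : irreflexive e) (r : nat) :
  exists theta : R, is_vartheta e (2 * r) theta /\
    [/\ (((alpha e)%:R^-1)%:E >= (theta^-1)%:E)%E,
        (theta^-1)%:E = FG_bound R e (2 * r + 2),
        FG_bound R e (2 * r + 2) = fG_po_bound R e (r + 1) &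
        (fG_po_bound R e (r + 1) >= fG_bound R e (r + 1))%E].
Proof.
have [l [l_gt0 fl max_l]] := max_feasible R n_gt0 e_irr r.
have fl' : sos (sqnorm R n ^+ (2 * r) * (l^-1 *: FG R e - sqnorm R n ^+ 2)).
  by apply/feasible_invP; rewrite ?invr_gt0 // invrK.
have [a_gt0 le_al] := alpha_le_feasible n_gt0 e_irr fl'.
(* Minimality of 1/l: any feasible s is at least alpha, hence positive, so 1/s is at most the
   largest l. *)
exists l^-1; rewrite invrK; split; last split.
- split=> [|s /(Kcone_varthetaP _ _ e_sym) fs]; first exact/Kcone_varthetaP.
  have [as_gt0 le_as] := alpha_le_feasible n_gt0 e_irr fs.
  have s_gt0 : 0 < s by apply: lt_le_trans le_as; rewrite ltr0n.
  have /max_l : sos (sqnorm R n ^+ (2 * r) * (FG R e - s^-1 *: sqnorm R n ^+ 2)).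
    exact/feasible_invP.
  by rewrite -[leRHS]invrK lef_pV2 // posrE invr_gt0.
- by rewrite lee_fin -[leLHS]invrK lef_pV2 // posrE ?invr_gt0 // ltr0n.
- apply/esym/ereal_sup_attained; first exact/FG_feasibleP.
  by move=> x /(FG_feasibleP _ _ _ n_gt0) /max_l.
- rewrite /FG_bound /fG_po_bound /sup_shift; congr (ereal_sup (image _ _)).
  (* The level 2r+2 is rewritten as twice r+1, the shape required by [po_feasibleP]. *)
  apply/funext => x; apply/propext; rewrite -[(2 * r + 2)%N]/(2 * r + 2 * 1)%N -mulnDr.
  exact: iff_sym (po_feasibleP _ _ _).
- apply: ge_ereal_sup => _ [x fx <-]; apply: ereal_sup_ubound; exists x => //.
  by case: fx => a [b [ha hb hE]]; exists a, b; split => //; exact: preord_trunc_qmodule.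
Qed.
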